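(* Let $f\in\mathbb{R}[x_1,\dots,x_n]$ be a multiaffine stable polynomial. If $f$ is SOS-Rayleigh, then $\frac{\partial f}{\partial x_k}$ and $f|_{x_k=0}$ are SOS-Rayleigh as well.
   Context: A nonzero polynomial $f\in\mathbb{C}[x_1,\dots,x_n]$ is stable if $f(x)\ne0$ whenever $\operatorname{Im}(x_i)>0$ for all $i$. A polynomial is multiaffine if it has degree at most one in each variable. For a multiaffine $h\in\mathbb{R}[x_1,\dots,x_n]$ the Rayleigh difference is $\Delta_{ij}(h)=\frac{\partial h}{\partial x_i}\frac{\partial h}{\partial x_j}-\frac{\partial^2 h}{\partial x_i\partial x_j}h$, and $h$ is called SOS-Rayleigh if $\Delta_{ij}(h)$ is a sum of squares of polynomials for all $1\le i,j\le n$. *)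

(* Defs.v *)
From HB Require Import structures.
From mathcomp Require Import all_boot all_order all_algebra.
From mathcomp Require Import reals.
From mathcomp Require Import complex mpoly.

Set Implicit Arguments.
Unset Strict Implicit.
Unset Printing Implicit Defensive.

Import Order.TTheory GRing.Theory Num.Theory.
Local Open Scope ring_scope.

Definition stable (R : realType) (n : nat) (p : {mpoly R[i][n]}) : Prop :=
  p != 0 /\
  forall x : 'I_n -> R[i], (forall i, 0 < complex.Im (x i)) -> p.@[x] != 0.

Definition complexify (R : realType) (n : nat) (p : {mpoly R[n]}) :
  {mpoly R[i][n]} := map_mpoly (real_complex R) p.

Definition multiaffine (R : realType) (n : nat) (p : {mpoly R[n]}) : Prop :=
  forall m : 'X_{1..n}, m \in msupp p -> forall i : 'I_n, (m i <= 1)%N.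

Definition sum_of_squares (R : realType) (n : nat) (p : {mpoly R[n]}) : Prop :=
  exists s : seq {mpoly R[n]}, p = \sum_(q <- s) q ^+ 2.

Definition rayleigh_diff (R : realType) (n : nat) (i j : 'I_n)
    (h : {mpoly R[n]}) : {mpoly R[n]} :=
  h^`M(i) * h^`M(j) - h^`M(j)^`M(i) * h.

(* The notion is only defined for multiaffine polynomials, so multiaffinity is
   part of the predicate. *)
Definition SOS_Rayleigh (R : realType) (n : nat) (h : {mpoly R[n]}) : Prop :=
  multiaffine h /\ forall i j : 'I_n, sum_of_squares (rayleigh_diff i j h).

(* f|_{x_k = 0}, kept in the same n variables (x_k no longer occurs). *)
Definition restrict0 (R : realType) (n : nat) (k : 'I_n) (f : {mpoly R[n]}) :
  {mpoly R[n]} := f \mPo [tuple (if i == k then 0 else 'X_i) | i < n].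

(* Main.v *)
(** Write f = x_k g + h with g = ∂f/∂x_k and h = f|_{x_k=0}, both free of x_k.
    For i, j <> k,
      Δ_ij(f) = x_k^2 Δ_ij(g) + x_k B + Δ_ij(h)
    with B free of x_k.  If this is a sum of squares of polynomials q, no
    cancellation can occur between the top x_k-coefficients of the q^2, so
    every q = q_0 + x_k q_1 is affine in x_k; hence Δ_ij(g) is the sum of the
    q_1^2 and Δ_ij(h) the sum of the q_0^2.  For i = k or j = k both Rayleigh
    differences vanish. *)
From HB Require Import structures.
Require Import Defs.
From mathcomp Require Import all_boot all_order all_algebra.
From mathcomp Require Import reals.
From mathcomp Require Import complex mpoly.
From mathcomp Require Import ring.

Set Implicit Arguments.
Unset Strict Implicit.
Unset Printing Implicit Defensive.

Import Order.TTheory GRing.Theory Num.Theory.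
Local Open Scope ring_scope.

(** Formal reality, the condition that rules out cancellation between top coefficients of squares.
    It has to hold in [{mpoly R[n]}], where the coefficients of powers of x_k live. *)
Definition real_ring (A : nzRingType) : Prop :=
  forall s : seq A, \sum_(a <- s) a ^+ 2 = 0 -> forall a, a \in s -> a = 0.

Lemma realDomain_real (R : realDomainType) : real_ring R.
Proof.
elim=> [|b s IH]; first by [].
rewrite big_cons => /eqP; rewrite paddr_eq0 ?sqr_ge0 ?sumr_ge0 //; last first.
  by move=> i _; rewrite sqr_ge0.
rewrite sqrf_eq0 => /andP[/eqP b0 /eqP s0] a.
by rewrite inE => /predU1P[->|/(IH s0)].
Qed.

(** Compare coefficients at twice the largest leading monomial M: only the coefficients at M
    contribute, through their squares, so these all vanish because R is formally real. *)
Lemma mpoly_real (R : realDomainType) (n : nat) : real_ring {mpoly R[n]}.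
Proof.
move=> s s0.
pose M : 'X_{1..n} := \big[Order.max/0%MM]_(q <- s) mlead q.
have leM q : q \in s -> (mlead q <= M)%O by move=> qs; exact: le_bigmax_seq.
have M0 q : q \in s -> q@_M = 0.
  move=> qs; apply: (@realDomain_real R [seq p@_M | p <- s]); last exact: map_f.
  transitivity (\sum_(p <- s) p ^+ 2)@_(M + M); last by rewrite s0 mcoeff0.
  rewrite big_map raddf_sum /=.
  by apply: eq_big_seq => p ps; rewrite !expr2 mleadcMW ?leM.
(* A maximum over a list is either its default value, here the zero monomial, or attained. *)
have [Mz|[q qs qM]] : M = 0%MM \/ exists2 q, q \in s & mlead q = M.
- rewrite /M big_seq; elim/big_ind: _ => [|x y hx hy|q qs]; first by left.
    by case: (leP x y).
  by right; exists q.
- move=> q qs; apply/eqP; rewrite -mleadc_eq0.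
  have /eqP-> : mlead q == M.
    by rewrite eq_le leM //= Mz le0x.
  by rewrite M0.
(* A q attaining M has zero leading coefficient, so q = 0 and M is again the zero monomial, the
   leading monomial of 0 by convention. *)
- have /eqP : mleadc q = 0 by rewrite qM M0.
  rewrite mleadc_eq0 => /eqP q0; move: qM; rewrite q0 mlead0 => Mz.
  move=> p ps; apply/eqP; rewrite -mleadc_eq0.
  have /eqP-> : mlead p == M by rewrite eq_le leM //= -Mz le0x.
  by rewrite M0.
Qed.

Lemma coef_sqr_top (A : comNzRingType) (p : {poly A}) (d : nat) :
  (size p <= d.+1)%N -> (p ^+ 2)`_(d + d) = p`_d ^+ 2.
Proof.
move=> sp; rewrite expr2 coefM.
have dlt : (d < (d + d).+1)%N by rewrite ltnS leq_addr.
rewrite (bigD1 (Ordinal dlt)) //= addnK big1 ?addr0 ?expr2 // => i ne.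
have {}ne : (i : nat) != d by apply: contraNneq ne => e; apply/eqP/val_inj.
case: (ltngtP i d) ne => // id _.
  rewrite [X in _ * X]nth_default ?mulr0 // (leq_trans sp) //.
  by rewrite ltn_subRL ltn_add2r.
by rewrite nth_default ?mul0r // (leq_trans sp).
Qed.

(** Descent on the excess e of a degree bound d + e: if all degrees are at most D > d, the
    coefficient of the sum at 2D is both zero, by the size hypothesis, and the sum of the squared
    coefficients at D. Formal reality kills the latter, so D can be lowered. *)
Lemma size_sum_squares (A : comNzRingType) (s : seq {poly A}) (d : nat) :
  real_ring A -> (size (\sum_(q <- s) q ^+ 2)%R <= d.*2.+1)%N ->
  forall q, q \in s -> (size q <= d.+1)%N.
Proof.
move=> realA sz.
suff bound e : (forall q, q \in s -> (size q <= (d + e).+1)%N) ->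
    forall q, q \in s -> (size q <= d.+1)%N.
  (* Any crude common bound starts the descent; the largest size is one. *)
  apply: (bound (\max_(q <- s) size q)) => q qs.
  by apply/leqW/(leq_trans _ (leq_addl _ _)); exact: leq_bigmax_seq.
elim: e => [|e IH] le_s; first by rewrite addn0 in le_s.
apply: IH => q qs; have := le_s q qs; rewrite addnS leq_eqVlt => /predU1P[sq|//].
have : q`_(d + e).+1 = 0.
  have := realA [seq p`_(d + e).+1 | p : {poly A} <- s]; apply; last first.
    exact: (map_f (fun p : {poly A} => p`_(d + e).+1)).
  transitivity (\sum_(p <- s) p ^+ 2)`_((d + e).+1 + (d + e).+1).
    rewrite big_map coef_sum; apply: eq_big_seq => p ps.
    by rewrite coef_sqr_top // -addnS le_s.
  rewrite nth_default // (leq_trans sz) // addSn addnS ltnS addnn.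
  by rewrite leqW // leq_double leq_addr.
move=> /eqP; rewrite -[X in q`_X]/((d + e).+2.-1) -sq -lead_coefE lead_coef_eq0.
by move=> /eqP->; rewrite size_poly0.
Qed.

Section SingleVariable.
Variables (R : realDomainType) (n : nat) (k : 'I_n).
Implicit Types (u : {mpoly R[n]}) (m : 'X_{1..n}).

(* Separates x_k from the other variables, which stay in the coefficients. *)
Definition poly_in : {mpoly R[n]} -> {poly {mpoly R[n]}} :=
  mmap (polyC \o mpolyC n (R := R))
       (fun i => if i == k then 'X else ('X_i)%:P).

HB.instance Definition _ := GRing.RMorphism.on poly_in.

Lemma poly_inX : poly_in 'X_k = 'X.
Proof. by rewrite /poly_in mmapX mmap1U eqxx. Qed.

(** A zero derivative is the working form of being free of x_k; the two agree because R has
    characteristic zero. *)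
Lemma mderiv_eq0P u :
  u^`M(k) = 0 <-> forall m, m \in msupp u -> m k = 0%N.
Proof.
split=> [u0 m mu|u0].
  case mk: (m k) => [//|j].
  have e : m = (m - U_(k) + U_(k))%MM.
    apply/mnmP=> i; rewrite !mnmE; case: eqP => [<-|_]; last by rewrite subn0 addn0.
    by rewrite mk subnK.
  have := congr1 (mcoeff (m - U_(k))%MM) u0.
  rewrite mcoeff_deriv -e mcoeff0 => /eqP.
  by rewrite mulrn_eq0 /= -[_ == 0]negbK -mcoeff_msupp mu.
apply/mpolyP => m; rewrite mcoeff_deriv mcoeff0 memN_msupp_eq0 ?mul0rn //.
by apply/negP => /u0; rewrite mnmDE mnm1E eqxx addn1.
Qed.

Lemma poly_in_const u : u^`M(k) = 0 -> poly_in u = u%:P.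
Proof.
move=> /mderiv_eq0P u0; rewrite {2}[u]mpolyE rmorph_sum /poly_in /mmap /=.
apply: eq_big_seq => m /u0 mk.
rewrite -mul_mpolyC rmorphM /= mpolyXE_id rmorph_prod /=; congr (_ * _).
apply: eq_bigr => i _; rewrite rmorphXn /=.
by case: eqP => [->|_] //; rewrite mk !expr0.
Qed.

Lemma sum_of_squares_extremal_coefs
    (a b c : {mpoly R[n]}) (s : seq {mpoly R[n]}) :
  a^`M(k) = 0 -> b^`M(k) = 0 -> c^`M(k) = 0 ->
  a * 'X_k ^+ 2 + b * 'X_k + c = \sum_(q <- s) q ^+ 2 ->
  a = \sum_(q <- s) (poly_in q)`_1 ^+ 2 /\
  c = \sum_(q <- s) (poly_in q)`_0 ^+ 2.
Proof.
move=> a0 b0 c0 e.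
have {e} : a%:P * 'X^2 + b%:P * 'X + c%:P = \sum_(q <- map poly_in s) q ^+ 2.
  have := congr1 poly_in e; rewrite rmorphD rmorphD rmorphM rmorphM rmorphXn /=.
  rewrite poly_inX (poly_in_const a0) (poly_in_const b0).
  rewrite (poly_in_const c0) => ->.
  by rewrite rmorph_sum big_map; apply: eq_bigr => q _; rewrite rmorphXn.
move=> e.
have coef_e j : (\sum_(q <- map poly_in s) q ^+ 2)`_j =
    a *+ (j == 2) + b *+ (j == 1)%N + c *+ (j == 0)%N.
  rewrite -[LHS]/(coefp j _) -e /= !coefD !coefCM coefXn coefX coefC.
  by case: j => [|[|[|j]]]; rewrite /= ?mulr0 ?mulr1 ?addr0.
have sz q : q \in map poly_in s -> (size q <= 2)%N.
  (* The sum is quadratic in X, so each [poly_in k q] is affine; its coefficient at 1 is then the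
     top one, and its square is the coefficient of the square at 2. *)
  apply: (size_sum_squares (d := 1)); first exact: mpoly_real.
  by apply/leq_sizeP => -[|[|[|j]]] // _; rewrite coef_e !addr0.
split.
  have := coef_e 2%N; rewrite /= !addr0 mulr1n coef_sum big_map => <-.
  by apply: eq_big_seq => q qs; rewrite (@coef_sqr_top _ _ 1) // sz // map_f.
have := coef_e 0%N; rewrite /= !add0r mulr1n coef_sum big_map => <-.
by apply: eq_bigr => q _; rewrite !expr2 coef0M.
Qed.

End SingleVariable.

Section Rayleigh.
Variables (R : realType) (n : nat).
Implicit Types (f g h : {mpoly R[n]}) (i j k : 'I_n) (m : 'X_{1..n}).

Lemma mcoeff_restrict0 k f m :
  (restrict0 k f)@_m = if m k == 0%N then f@_m else 0.
Proof.
have restrictX m' : 'X_[m'] \mPo [tuple (if i == k then 0 else 'X_i) | i < n]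
    = if m' k == 0%N then 'X_[m'] else 0 :> {mpoly R[n]}.
  rewrite comp_mpolyX; case: eqP => [mk|/eqP mk]; last first.
    by rewrite (bigD1 k) //= tnth_mktuple eqxx expr0n (negPf mk) mul0r.
  rewrite mpolyXE_id; apply: eq_bigr => i _; rewrite tnth_mktuple.
  by case: eqP => [->|_] //; rewrite mk !expr0.
rewrite /restrict0 comp_mpolyEX raddf_sum /= {3}[f]mpolyE raddf_sum /=.
have -> : (if m k == 0%N then \sum_(m' <- msupp f) (f@_m' *: 'X_[m'])@_m else 0)
   = \sum_(m' <- msupp f) (if m k == 0%N then (f@_m' *: 'X_[m'])@_m else 0).
  by case: eqP => // _; rewrite big1.
apply: eq_bigr => m' _; rewrite restrictX !mcoeffZ.
case: (m' =P m) => [->|ne]; first by case: eqP => //; rewrite mcoeff0 mulr0.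
have /negPf ne' : m' != m by apply/eqP.
by rewrite (fun_if (mcoeff m)) mcoeffX ne' mcoeff0 !if_same mulr0 if_same.
Qed.

Lemma mderiv_restrict0 k f : (restrict0 k f)^`M(k) = 0.
Proof.
apply/mpolyP => m; rewrite mcoeff_deriv mcoeff_restrict0 mcoeff0.
by rewrite mnmDE mnm1E eqxx addn1 mul0rn.
Qed.

Lemma multiaffine_restrict0 k f : multiaffine f -> multiaffine (restrict0 k f).
Proof.
move=> fM m; rewrite mcoeff_msupp mcoeff_restrict0.
by case: (m k == 0%N); [rewrite -mcoeff_msupp => /fM | rewrite eqxx].
Qed.

Lemma multiaffine_mderiv k f : multiaffine f -> multiaffine f^`M(k).
Proof.
move=> fM m; rewrite mcoeff_msupp mcoeff_deriv mulrn_eq0 /= -mcoeff_msupp.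
by move=> /fM le1 i; apply: leq_trans (le1 i); rewrite mnmDE leq_addr.
Qed.

Lemma multiaffine_mderiv2 k f : multiaffine f -> f^`M(k)^`M(k) = 0.
Proof.
move=> fM; apply/mpolyP => m; rewrite !mcoeff_deriv mcoeff0 memN_msupp_eq0 ?mul0rn //.
by apply/negP => /fM/(_ k); rewrite !mnmDE mnm1E eqxx !addn1.
Qed.

Lemma multiaffine_split k f :
  multiaffine f -> f = f^`M(k) * 'X_k + restrict0 k f.
Proof.
move=> fM; apply/mpolyP => m; rewrite mcoeffD mcoeff_restrict0.
case: eqP => [mk|/eqP mk].
  (* A monomial without x_k cannot occur in a multiple of ['X_k]. *)
  rewrite [X in _ = X + _]memN_msupp_eq0 ?add0r //; apply/negP => /msuppM_le/allpairsP[[m1 m2]] /=.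
  rewrite msuppX inE => -[_ /eqP-> e].
  by move: mk; rewrite e mnmDE mnm1E eqxx addn1.
have e : m = (U_(k) + (m - U_(k)))%MM.
  apply/mnmP=> i; rewrite !mnmE; case: eqP => [<-|_]; last by rewrite subn0.
  by rewrite addnC subnK // lt0n.
rewrite addr0 [in RHS]e mcoeffMX mcoeff_deriv addmC -e.
have [mf|mf] := boolP (m \in msupp f); last by rewrite memN_msupp_eq0 ?mul0rn.
have mk1 := fM m mf k.
(* Multiaffinity forces m k = 1, so the factor produced by differentiation is 1. *)
by rewrite mnmBE mnm1E eqxx; case: (m k) mk mk1 => [|[|]].
Qed.

Lemma rayleigh_diff_const k i j f :
  f^`M(k) = 0 -> (i == k) || (j == k) -> rayleigh_diff i j f = 0.
Proof.
rewrite /rayleigh_diff => f0 /orP[]/eqP->; rewrite f0.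
  by rewrite mderiv_comm f0 mderiv0 !mul0r subr0.
by rewrite mderiv0 mulr0 mul0r subr0.
Qed.

Lemma mderiv_rayleigh_diff k i j f :
  f^`M(k) = 0 -> (rayleigh_diff i j f)^`M(k) = 0.
Proof.
move=> f0; have d l : f^`M(l)^`M(k) = 0 by rewrite mderiv_comm f0 mderiv0.
have dd : f^`M(j)^`M(i)^`M(k) = 0 by rewrite mderiv_comm d mderiv0.
by rewrite mderivB !mderivM !d dd f0; ring.
Qed.

Lemma SOS_Rayleigh_split k i j f : multiaffine f ->
  sum_of_squares (rayleigh_diff i j f) ->
  sum_of_squares (rayleigh_diff i j f^`M(k)) /\
  sum_of_squares (rayleigh_diff i j (restrict0 k f)).
Proof.
move=> fM [s fs].
have g0 := multiaffine_mderiv2 k fM; have h0 := mderiv_restrict0 k f.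
have [ijk|] := boolP ((i == k) || (j == k)).
  by split; exists [::]; rewrite (rayleigh_diff_const (k := k)) ?big_nil.
rewrite negb_or => /andP[/negPf ik /negPf jk].
have := multiaffine_split k fM.
(* From here on g and h are arbitrary polynomials free of x_k with f = g x_k + h. *)
move: f^`M(k) (restrict0 k f) g0 h0 => g h g0 h0 ef.
(* The cross terms of the quadratic expression [rayleigh_diff i j] at g x_k + h, that is, its
   polarization at (g, h). *)
pose b := g^`M(i) * h^`M(j) + h^`M(i) * g^`M(j)
          - (g^`M(j)^`M(i) * h + h^`M(j)^`M(i) * g).
have b0 : b^`M(k) = 0.
  have d u l : u^`M(k) = 0 -> u^`M(l)^`M(k) = 0.
    by move=> u0; rewrite mderiv_comm u0 mderiv0.
  by rewrite mderivB !mderivD !mderivM g0 h0 !d //; [ring | exact: d ..].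
(* Since i and j differ from k, x_k acts as a scalar for both derivations, which makes the expansion
   purely algebraic. *)
have dX l u : (l == k) = false -> (u * 'X_k)^`M(l) = u^`M(l) * 'X_k.
  move=> lk; rewrite mderivM mderivX mnm1E eq_sym lk.
  by rewrite scale0r mulr0 addr0.
have e : rayleigh_diff i j g * 'X_k ^+ 2 + b * 'X_k + rayleigh_diff i j h
         = \sum_(q <- s) q ^+ 2.
  rewrite -fs ef /rayleigh_diff /b !mderivD !dX //; ring.
have [] := sum_of_squares_extremal_coefs
  (mderiv_rayleigh_diff i j g0) b0 (mderiv_rayleigh_diff i j h0) e.
move=> eg eh; split; [exists [seq (poly_in k q)`_1 | q <- s]
                     |exists [seq (poly_in k q)`_0 | q <- s]];
  by rewrite big_map.
Qed.

End Rayleigh.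

Theorem theorem2p12 (R : realType) (n : nat) (f : {mpoly R[n]}) :
  multiaffine f -> stable (complexify f) -> SOS_Rayleigh f ->
  forall k : 'I_n, SOS_Rayleigh (f^`M(k)) /\ SOS_Rayleigh (restrict0 k f).
Proof.
move=> fM _ [_ fS] k; split; split.
- exact: multiaffine_mderiv.
- by move=> i j; have [] := SOS_Rayleigh_split k fM (fS i j).
- exact: multiaffine_restrict0.
- by move=> i j; have [] := SOS_Rayleigh_split k fM (fS i j).
Qed.
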